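(* Let $E_1$ be a real Hilbert space and $E_2$ a normed vector space. Let $A\in\mathcal L(E_1,E_2)$, let $\mathcal M\subset E_1$ be nonempty, norm closed, and convex, and suppose that the restriction $A|_{\mathcal M}$ is injective. Let $f\in\mathcal M$ and set $F=Af$. For every $m\in\mathbb N^+$, let $(\mathcal X_m,\mu_m)$ be a probability space, and for each $S_m\in\mathcal X_m$ let $F_{S_m}\in E_2$ and $A_{S_m}\in\mathcal L(E_1,E_2)$ (no measurability in $S_m$ is assumed). For $\gamma_m>0$ define $R_{\gamma_m}(\cdot,F_{S_m},A_{S_m}):\mathcal M\to\mathbb R_{\ge 0}$ by $$R_{\gamma_m}(h,F_{S_m},A_{S_m})=\|A_{S_m}h-F_{S_m}\|_{E_2}^2+\gamma_m\|h\|_{E_1}^2 .$$ 1) Then $R_{\gamma_m}(\cdot,F_{S_m},A_{S_m})$ has a unique minimizer $f_{S_m}\in\mathcal M$. 2) Fix $\varepsilon>0$, and choose $C_1>0$ and $C_2\ge 0$ such that $(C_1+C_2\|f\|_{E_1})^2<\varepsilon$. Then there exists $\gamma_0=\gamma_0(\varepsilon,C_1,C_2,f,A,\mathcal M)>0$ (depending only on the listed data) such that, whenever $\gamma_m\le\gamma_0$, $$\mu_m^*\bigl\{S_m:\|f_{S_m}-f\|_{E_1}^2>\varepsilon\bigr\}\le \mu_m^*\bigl\{S_m:\|F_{S_m}-F\|_{E_2}>C_1\sqrt{\gamma_m}\bigr\}+\mu_m^*\bigl\{S_m:\|A_{S_m}-A\|_{\mathrm{op}}>C_2\sqrt{\g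amma_m}\bigr\}.$$
   Context: $\mathcal L(E_1,E_2)$ denotes the space of bounded linear operators from $E_1$ to $E_2$, and $\|\cdot\|_{\mathrm{op}}$ its operator norm. $\mu_m^*$ denotes the outer measure defined by $\mu_m$ (the sets involved need not be measurable). *)

(* Defs.v *)
From HB Require Import structures.
From mathcomp Require Import all_boot all_order all_algebra.
From mathcomp Require Import all_classical all_reals all_analysis.

Set Implicit Arguments.
Unset Strict Implicit.
Unset Printing Implicit Defensive.

Import Order.TTheory GRing.Theory Num.Theory.
Import numFieldNormedType.Exports.

Local Open Scope classical_set_scope.
Local Open Scope ring_scope.

HB.mixin Record isHilbert (R : realType) E of CompleteNormedModule R E := {
  inner : {dot E for (@idfun R)} ;
  inner_sqr_norm : forall x : E, inner x x = `|x| ^+ 2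
}.

#[short(type="hilbertType")]
HB.structure Definition Hilbert (R : realType) :=
  {E of isHilbert R E & CompleteNormedModule R E}.

Section Operators.
Variables (R : realType) (E1 E2 : normedModType R).

Definition bounded_operator (A : E1 -> E2) :=
  exists K : R, forall x, `|A x| <= K * `|x|.

(* [sup] takes the value 0 on sets without an upper bound, so this is the
   operator norm only for bounded linear maps. *)
Definition opnorm (A : E1 -> E2) : R :=
  sup [set `|A x| | x in [set x : E1 | `|x| <= 1]].

Definition regularized_risk (gamma : R) (G : E2) (B : E1 -> E2) (h : E1) : R :=
  `|B h - G| ^+ 2 + gamma * `|h| ^+ 2.

End Operators.

Definition minimizer (R : realType) (T : Type) (D : set T) (J : T -> R) (x : T) :=
  D x /\ forall y, D y -> J x <= J y.

(* Main.v *)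
(** Sublevel sets of the risk are closed, convex and bounded, so a Cantor-type
    intersection theorem for nested closed convex bounded sets in a Hilbert space
    yields the minimizer; strict convexity makes it unique. For the estimate, put
    [c = (C1 + C2 |f|)^2 < eps]. Off the two exceptional events, comparing the
    risks of the minimizer [h] and of [f] gives [|h|^2 <= |f|^2 + c] and
    [|A h - A f| = O(sqrt gamma)]. If [|h - f|^2 > eps], then [h] also lies in the
    closed half-space [|h|^2 - |h - f|^2 <= |f|^2 + c - eps], which misses [f].
    If such [h] existed with [A h] arbitrarily near [A f], the same intersection
    theorem would produce a point of [M] in this half-space with image [A f],
    that is [f] itself by injectivity. *)
Require Import Defs.
From HB Require Import structures.
From mathcomp Require Import all_boot all_order all_algebra.
From mathcomp Require Import all_classical all_reals all_analysis.
From mathcomp Require Import ring lra.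

Set Implicit Arguments.
Unset Strict Implicit.
Unset Printing Implicit Defensive.

Import Order.TTheory GRing.Theory Num.Theory.
Import numFieldNormedType.Exports.

Local Open Scope classical_set_scope.
Local Open Scope ring_scope.

(** * Midpoint convexity, continuity and bounded operators *)

Definition midpoint_closed (R : numFieldType) (E : lmodType R) (C : set E) :=
  forall x y, C x -> C y -> C (2^-1 *: (x + y)).

(** Midpoints are enough: each convexity argument below compares two points with their midpoint. *)
Lemma convex_midpoint_closed (R : numFieldType) (E : lmodType R) (C : set E) :
  convex_set (C : set (convex_lmodType E)) -> midpoint_closed C.
Proof.
move=> cC x y Cx Cy.
have h0 : (0 <= 2^-1 :> R) by rewrite invr_ge0 ler0n.
have h1 : (2^-1 <= 1 :> R) by rewrite invf_le1 ?ltr0n// ler1n.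
have := cC x y (Itv01 h0 h1) (mem_set Cx) (mem_set Cy).
have -> : conv (Itv01 h0 h1) (x : convex_lmodType E) (y : convex_lmodType E)
          = 2^-1 *: x + (1 - 2^-1) *: y by [].
by rewrite {1}[X in X - 2^-1](splitr 1) div1r addrK -scalerDr inE.
Qed.

Lemma closed_sublevel (R : realType) (T : topologicalType) (g : T -> R)
    (c : R) :
  continuous g -> closed [set x | g x <= c].
Proof.
move=> /continuous_closedP cg.
by apply: (cg [set t | t <= c]); exact: closed_le.
Qed.

Lemma continuous_sqr_norm (R : realType) (T : topologicalType)
    (V : normedModType R) (g : T -> V) :
  continuous g -> continuous (fun x => `|g x| ^+ 2).
Proof.
move=> cg x; rewrite /continuous_at expr2.
under eq_cvg do rewrite expr2.
by apply: cvgM; apply: cvg_norm; exact: cg.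
Qed.

Lemma bounded_operator_continuous (R : realType) (E1 E2 : normedModType R)
    (T : {linear E1 -> E2}) : bounded_operator T -> continuous T.
Proof.
move=> [K TK]; apply/linear_bounded_continuous/linear_boundedP.
near=> r => x; apply: le_trans (TK x) _; apply: ler_wpM2r => //.
Unshelve. all: by end_near. Qed.

Lemma bounded_operatorB (R : realType) (E1 E2 : normedModType R)
    (T U : E1 -> E2) :
  bounded_operator T -> bounded_operator U -> bounded_operator (T \- U).
Proof.
move=> [K TK] [L UL]; exists (K + L) => x /=.
by rewrite mulrDl (le_trans (ler_normB _ _))// lerD.
Qed.

(** Rescale [x] to the unit sphere. Boundedness of [T] keeps the supremum away from its default
    value. *)
Lemma le_opnorm (R : realType) (E1 E2 : normedModType R)
    (T : {linear E1 -> E2}) (x : E1) :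
  bounded_operator T -> `|T x| <= opnorm T * `|x|.
Proof.
move=> [K TK]; have [->|x0] := eqVneq x 0.
  by rewrite linear0 !normr0 mulr0.
have nx : 0 < `|x| by rewrite normr_gt0.
rewrite -ler_pdivrMr// mulrC -[X in X * _](@gtr0_norm _ `|x|^-1) ?invr_gt0//.
rewrite -normrZ -linearZ; apply: ub_le_sup.
  exists `|K| => _ [y /= y1 <-]; apply: le_trans (TK y) _.
  apply: (le_trans (ler_norm _)); rewrite normrM normr_id.
  by rewrite ler_piMr.
exists (`|x|^-1 *: x) => //=.
by rewrite normrZ gtr0_norm ?invr_gt0// mulVf// gt_eqF.
Qed.

(** * Midpoint estimates and nested intersections in Hilbert space *)

Lemma sqr_norm_midpoint_le (R : realType) (E : normedModType R) (x y : E) :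
  `|2^-1 *: (x + y)| ^+ 2 <= 2^-1 * `|x| ^+ 2 + 2^-1 * `|y| ^+ 2.
Proof.
rewrite normrZ ger0_norm ?invr_ge0//.
have := ler_normD x y; have := normr_ge0 (x + y).
have := sqr_ge0 (`|x| - `|y|).
move: `|x + y| `|x| `|y| => a b c; nra.
Qed.

(** The exact defect [4^-1 * |x - y|^2] yields both the Cauchy estimate and the strict convexity of
    the risk. *)
Lemma parallelogram (R : realType) (E : hilbertType R) (x y : E) :
  `|2^-1 *: (x + y)| ^+ 2
  = 2^-1 * `|x| ^+ 2 + 2^-1 * `|y| ^+ 2 - 4^-1 * `|x - y| ^+ 2.
Proof.
rewrite -!inner_sqr_norm linearZl_LR linearZr_LR /=.
rewrite !(linearDl, linearDr, linearNl, linearNr) /=.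
by field.
Qed.

Lemma midpointB (R : numFieldType) (E : lmodType R) (x y z : E) :
  2^-1 *: (x + y) - z = 2^-1 *: ((x - z) + (y - z)).
Proof.
rewrite addrACA -opprD scalerBr; congr (_ - _).
by rewrite -mulr2n -[z *+ 2]scaler_nat scalerA mulVf ?scale1r// pnatr_eq0.
Qed.

(* A Hilbert-space form of weak compactness: almost norm-minimal points of the
   sets form a Cauchy sequence by the parallelogram identity. *)
Lemma nested_midpoint_closed_inhabited (R : realType) (E : hilbertType R)
    (C : nat -> set E) (K : R) :
  (forall n, closed (C n)) -> (forall n, midpoint_closed (C n)) ->
  (forall m n, (m <= n)%N -> C n `<=` C m) -> (forall n, C n !=set0) ->
  (forall x, C 0%N x -> `|x| ^+ 2 <= K) ->
  exists x, forall n, C n x.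
Proof.
move=> Ccl Cmid Cdec Cne CK.
pose sq n := [set `|x| ^+ 2 | x in C n].
have sq_lb n : has_lbound (sq n) by exists 0 => _ [x _ <-]; exact: sqr_ge0.
have sq_inf n : has_inf (sq n).
  by split; [have [x Cx] := Cne n; exists (`|x| ^+ 2), x|].
pose D := [set inf (sq n) | n in [set: nat]].
have D_sup : has_sup D.
  split; first by exists (inf (sq 0%N)), 0%N.
  exists K => _ [n _ <-]; have [x Cx] := Cne n.
  apply: (@le_trans _ _ (`|x| ^+ 2)); first by apply: ge_inf => //; exists x.
  exact/CK/(Cdec 0%N n).
(* The infima [inf (sq n)] increase with [n], since the sets shrink, and stay below [K]; [d] is
   their limit. *)
pose d := sup D.
have [x xP] : {x : nat -> E &
    forall n, C n (x n) /\ `|x n| ^+ 2 < d + n.+1%:R^-1}.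
  apply: (@choice _ _ (fun n y => C n y /\ `|y| ^+ 2 < d + n.+1%:R^-1)) => n.
  have [|_ [y Cy <-] ylt] := @inf_adherent _ (sq n) n.+1%:R^-1 _ (sq_inf n).
    by rewrite invr_gt0.
  exists y; split=> //; apply: lt_le_trans ylt _; rewrite lerD2r.
  by apply: ub_le_sup; [case: D_sup|exists n].
have x_cauchy : cauchy (x @ \oo).
  apply/cauchy_exP => e e0.
  (* Two late points have squared norm below [d + e^2/8], and their midpoint, lying in [C N], has
     squared norm above [d - e^2/8]. The parallelogram identity then gives
     [|x - y|^2 / 4 < e^2 / 4]. *)
  have h0 : 0 < e ^+ 2 / 8 by rewrite divr_gt0// exprn_gt0.
  have [_ [N _ <-] Nd] := sup_adherent h0 D_sup.
  have [N' N'e] : exists n, n.+1%:R^-1 < e ^+ 2 / 8.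
    by have [n _ /(_ n (leqnn n))] := near_infty_natSinv_lt (PosNum h0); exists n.
  have key m : (maxn N N' <= m)%N -> C N (x m) /\ `|x m| ^+ 2 < d + e ^+ 2 / 8.
    rewrite geq_max => /andP[Nm N'm]; have [Cx xd] := xP m.
    split; first exact: Cdec Cx.
    apply: (lt_trans xd); rewrite ltrD2l; apply: le_lt_trans N'e.
    by rewrite lef_pV2 ?posrE// ler_nat ltnS.
  exists (x (maxn N N')).
  have : \forall n \near \oo, ball (x (maxn N N')) e (x n); last by [].
  near=> n.
  have [CxN xN] := key _ (leqnn _).
  have [Cxn xn] : C N (x n) /\ `|x n| ^+ 2 < d + e ^+ 2 / 8.
    by apply: key; near: n; exact: nbhs_infty_ge.
  have : inf (sq N) <= `|2^-1 *: (x (maxn N N') + x n)| ^+ 2.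
    apply: ge_inf => //; exists (2^-1 *: (x (maxn N N') + x n)) => //.
    exact: Cmid.
  rewrite parallelogram => infle.
  rewrite -ball_normE /ball_ /= -(ltr_pXn2r (n := 2)) ?nnegrE ?(ltW e0)//.
  by rewrite -/d in Nd; lra.
have xl : x @ \oo --> limn x by exact: cauchy_cvg.
exists (limn x) => n; apply: (closed_cvg (C n) (Ccl n) _ _ xl).
near=> m; apply: (Cdec n m); last by case: (xP m).
by near: m; exact: nbhs_infty_ge.
Unshelve. all: by end_near. Qed.

(** * Existence and uniqueness of the minimizer *)

Section RegularizedRisk.
Variables (R : realType) (E1 : hilbertType R) (E2 : normedModType R).
Variables (gamma : R) (G : E2) (B : {linear E1 -> E2}).
Hypotheses (gamma_gt0 : 0 < gamma) (B_bounded : bounded_operator B).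

(** The data term is convex in any norm, and the Hilbert penalty supplies the strict gap, whatever
    [B] is. *)
Lemma regularized_risk_midpoint (x y : E1) :
  regularized_risk gamma G B (2^-1 *: (x + y))
  <= 2^-1 * regularized_risk gamma G B x + 2^-1 * regularized_risk gamma G B y
     - gamma / 4 * `|x - y| ^+ 2.
Proof.
rewrite /regularized_risk linearZ linearD midpointB parallelogram.
have := sqr_norm_midpoint_le (B x - G) (B y - G).
by move: (`|_| ^+ 2) => a; lra.
Qed.

Lemma continuous_regularized_risk : continuous (regularized_risk gamma G B).
Proof.
move=> x; apply: cvgD; last apply: cvgMr.
  apply: (@continuous_sqr_norm _ _ _ (fun y => B y - G)) => y.
  apply: cvgB; last exact: cvg_cst.
  exact: bounded_operator_continuous.
by apply: (@continuous_sqr_norm _ _ _ id) => y; exact: cvg_id.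
Qed.

Lemma regularized_risk_ge0 (x : E1) : 0 <= regularized_risk gamma G B x.
Proof. by rewrite addr_ge0 ?sqr_ge0// mulr_ge0 ?sqr_ge0// ltW. Qed.

Lemma minimizer_regularized_risk_unique (M : set E1) (x y : E1) :
  midpoint_closed M ->
  minimizer M (regularized_risk gamma G B) x ->
  minimizer M (regularized_risk gamma G B) y -> x = y.
Proof.
move=> Mmid [Mx minx] [My miny].
pose J : E1 -> R := regularized_risk gamma G B.
have Jmid : J (2^-1 *: (x + y))
    <= 2^-1 * J x + 2^-1 * J y - gamma / 4 * `|x - y| ^+ 2.
  exact: regularized_risk_midpoint.
have Jx : J x <= J (2^-1 *: (x + y)) by exact: minx (Mmid _ _ Mx My).
have Jy : J y <= J x by exact: miny.
have : gamma / 4 * `|x - y| ^+ 2 <= 0 by lra.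
rewrite pmulr_rle0 ?divr_gt0// exprn_even_le0//= normr_eq0 subr_eq0.
by move=> /eqP.
Qed.

Lemma minimizer_regularized_risk_exists (M : set E1) :
  M !=set0 -> closed M -> midpoint_closed M ->
  exists x, minimizer M (regularized_risk gamma G B) x.
Proof.
move=> [m0 Mm0] Mcl Mmid; pose J : E1 -> R := regularized_risk gamma G B.
have J_lb : has_lbound [set J x | x in M].
  by exists 0 => _ [x _ <-]; exact: regularized_risk_ge0.
have J_inf : has_inf [set J x | x in M] by split => //; exists (J m0), m0.
pose i := inf [set J x | x in M].
pose C n := M `&` [set x | J x <= i + n.+1%:R^-1].
(* The bound [(i + 1) / gamma] comes from level [n = 0], where [gamma * |x|^2 <= J x <= i + 1]. *)
have [|n x y [Mx Jx] [My Jy]|m n mn x [Mx Jx]|n|x [_ Jx]|x Cx] :=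
  @nested_midpoint_closed_inhabited _ _ C ((i + 1) / gamma).
- move=> n; apply: closedI => //; apply: closed_sublevel.
  exact: continuous_regularized_risk.
- split; first exact: Mmid.
  move: Jx Jy => /=; move: (i + _) => c Jx Jy.
  have Jmid : J (2^-1 *: (x + y))
      <= 2^-1 * J x + 2^-1 * J y - gamma / 4 * `|x - y| ^+ 2.
    exact: regularized_risk_midpoint.
  have : 0 <= gamma / 4 * `|x - y| ^+ 2.
    by rewrite mulr_ge0 ?sqr_ge0// divr_ge0// ltW.
  lra.
- split=> //=; apply: (le_trans Jx).
  by rewrite lerD2l lef_pV2 ?posrE// ler_nat ltnS.
- have [|_ [x Mx <-] Jx] := @inf_adherent _ _ n.+1%:R^-1 _ J_inf.
    by rewrite invr_gt0.
  by exists x; split => //=; exact: ltW.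
- rewrite ler_pdivlMr// mulrC; move: Jx; rewrite /= invr1; apply: le_trans.
  by rewrite lerDr sqr_ge0.
- exists x; split=> [|y My]; first by case: (Cx 0%N).
  apply: (@le_trans _ _ i); last by apply: ge_inf => //; exists y.
  apply/ler_addgt0Pl => e e0.
  have [n _ /(_ n (leqnn n)) /= ne] := near_infty_natSinv_lt (PosNum e0).
  case: (Cx n) => _ /= /le_trans; apply; rewrite addrC lerD2r.
  exact: ltW.
Qed.

End RegularizedRisk.

(** * Closeness of the minimizer to [f] *)

Section Stability.
Variables (R : realType) (E1 : hilbertType R) (E2 : normedModType R).
Variables (A : {linear E1 -> E2}) (A_bounded : bounded_operator A).
Variables (M : set E1) (f : E1) (Mf : M f).

(** The compactness argument gives no explicit [n], but [n] is fixed before any [gamma], [G] or [B]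
    appears. *)
Lemma near_injective_image_close (c eps : R) :
  closed M -> midpoint_closed M -> set_inj M A -> c < eps ->
  exists n : nat, forall h, M h -> `|h| ^+ 2 <= `|f| ^+ 2 + c ->
    `|A h - A f| ^+ 2 <= n.+1%:R^-1 -> `|h - f| ^+ 2 <= eps.
Proof.
move=> Mcl Mmid Ainj ceps; apply: contrapT => /forallNP far.
(* The condition [|h - f|^2 > eps] is not convex. With the norm bound it implies the last
   constraint, a half-space that excludes [f] because [c < eps]. *)
pose C n : set E1 := [set h | [/\ M h, `|h| ^+ 2 <= `|f| ^+ 2 + c,
  `|A h - A f| ^+ 2 <= n.+1%:R^-1 &
  `|h| ^+ 2 - `|h - f| ^+ 2 <= `|f| ^+ 2 + c - eps]].
have [n|n x y [Mx x1 x2 x3] [My y1 y2 y3]|m n mn h [Mh h1 h2 h3]|n|h []//|h Ch]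
  := @nested_midpoint_closed_inhabited _ _ C (`|f| ^+ 2 + c).
- have -> : C n = M `&` [set h | `|h| ^+ 2 <= `|f| ^+ 2 + c]
      `&` [set h | `|A h - A f| ^+ 2 <= n.+1%:R^-1]
      `&` [set h | `|h| ^+ 2 - `|h - f| ^+ 2 <= `|f| ^+ 2 + c - eps].
    by apply/seteqP; split=> h [] => [|[[]]].
  have cnorm : continuous (fun h : E1 => `|h| ^+ 2).
    by apply: (@continuous_sqr_norm _ _ _ id) => h; exact: cvg_id.
  apply: closedI;
    last (apply: closed_sublevel => h; apply: cvgB; first exact: cnorm).
    apply: closedI; [apply: closedI => //; exact: closed_sublevel|].
    apply: closed_sublevel.
    apply: (@continuous_sqr_norm _ _ _ (fun h => A h - A f)).
    move=> h; apply: cvgB; last exact: cvg_cst.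
    exact: bounded_operator_continuous.
  apply: (@continuous_sqr_norm _ _ _ (fun h => h - f)) => z.
  by apply: cvgB; [exact: cvg_id|exact: cvg_cst].
- have nonneg : 0 <= `|x - y| ^+ 2 by exact: sqr_ge0.
  split; first exact: Mmid.
  + by rewrite parallelogram; lra.
  + rewrite linearZ linearD midpointB.
    apply: le_trans (sqr_norm_midpoint_le _ _) _.
    by move: x2 y2; move: (_^-1) => e; lra.
  (* The quadratic terms cancel: the constraint is affine in [h]. *)
  + rewrite midpointB !parallelogram.
    have -> : x - f - (y - f) = x - y by rewrite opprB addrA subrK.
    by lra.
- split=> //; apply: (le_trans h2).
  by rewrite lef_pV2 ?posrE// ler_nat ltnS.
- have := far n; apply: contra_notP => /forallNP Cn0 h Mh h1 h2.
  by rewrite leNgt; apply/negP => h3; apply: (Cn0 h); split => //; lra.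
- have [Mh _ _ h3] := Ch 0%N.
  have /eqP : `|A h - A f| ^+ 2 = 0.
    apply/eqP; rewrite eq_le sqr_ge0 andbT; apply/ler_addgt0Pl => e e0.
    have [n _ /(_ n (leqnn n)) /= ne] := near_infty_natSinv_lt (PosNum e0).
    have [_ _ h2 _] := Ch n.
    by rewrite addr0 (le_trans h2)// ltW.
  rewrite sqrf_eq0 normr_eq0 subr_eq0 => /eqP Ahf.
  have hf : h = f by apply: Ainj; rewrite ?inE.
  by move: h3; rewrite hf subrr normr0 expr0n/=; lra.
Qed.

(** Each error at [f] is of order [sqrt gamma], so the risk of [f] is at most [gamma * r^2], and so
    is that of [h]. *)
Lemma regularized_risk_minimizer_bounds (gamma C1 C2 r : R) (G : E2)
    (B : {linear E1 -> E2}) (h : E1) :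
  bounded_operator B -> 0 < gamma -> 0 <= C1 -> 0 <= C2 -> 0 <= r ->
  `|f| ^+ 2 + (C1 + C2 * `|f|) ^+ 2 = r ^+ 2 ->
  `|G - A f| <= C1 * Num.sqrt gamma ->
  opnorm (B \- A) <= C2 * Num.sqrt gamma ->
  minimizer M (regularized_risk gamma G B) h ->
  `|h| <= r /\ `|A h - A f| <= (r + C1 + C2 * r) * Num.sqrt gamma.
Proof.
move=> Bb g0 C10 C20 r0 rE Gf BA [Mh /(_ _ Mf)]; rewrite /regularized_risk.
have BAle x : `|B x - A x| <= C2 * Num.sqrt gamma * `|x|.
  apply: (@le_trans _ _ (opnorm (B \- A) * `|x|)).
    exact: (le_opnorm x (bounded_operatorB Bb A_bounded)).
  exact: ler_wpM2r.
set s := Num.sqrt gamma in Gf BA BAle *.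
have sE : gamma = s ^+ 2 by rewrite sqr_sqrtr// ltW.
have s0 : 0 < s by rewrite sqrtr_gt0.
have Bf : `|B f - G| <= s * (C1 + C2 * `|f|).
  have -> : B f - G = (B f - A f) - (G - A f) by rewrite opprB addrA subrK.
  apply: (le_trans (ler_normB _ _)).
  by have := lerD (BAle f) Gf; lra.
have Bf2 : `|B f - G| ^+ 2 <= s ^+ 2 * (C1 + C2 * `|f|) ^+ 2.
  have C0 : 0 <= s * (C1 + C2 * `|f|).
    by apply: mulr_ge0; [exact: ltW|apply: addr_ge0 => //; exact: mulr_ge0].
  by rewrite -exprMn ler_sqr ?nnegrE.
rewrite sE => hf.
have hs : `|B h - G| ^+ 2 + s ^+ 2 * `|h| ^+ 2 <= s ^+ 2 * r ^+ 2.
  by rewrite -rE; apply: (le_trans hf); lra.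
(* Dropping the data term bounds [|h|]; dropping the penalty bounds the residual by [s * r]. *)
have hr : `|h| <= r.
  rewrite -ler_sqr ?nnegrE// -(ler_pM2l (exprn_gt0 2 s0)).
  by apply: le_trans hs; rewrite lerDr sqr_ge0.
have BhG : `|B h - G| <= s * r.
  rewrite -ler_sqr ?nnegrE ?mulr_ge0 ?(ltW s0)// exprMn.
  by apply: le_trans hs; rewrite lerDl mulr_ge0 ?sqr_ge0.
split=> //.
(* The three differences contribute [C2 * s * r], [s * r] and [C1 * s]. *)
have <- : A h - B h + (B h - G + (G - A f)) = A h - A f by rewrite !subrKA.
apply: (le_trans (ler_normD _ _)); rewrite [`|A h - B h|]distrC.
have := ler_normD (B h - G) (G - A f).
have : C2 * s * `|h| <= C2 * s * r by rewrite ler_wpM2l// mulr_ge0// ltW.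
have := BAle h; lra.
Qed.

End Stability.

Theorem theorem2p1 (R : realType) (E1 : hilbertType R) (E2 : normedModType R)
    (A : {linear E1 -> E2}) (A_bounded : bounded_operator A)
    (M : set E1) (M_nonempty : M !=set0) (M_closed : closed M)
    (M_convex : convex_set (M : set (convex_lmodType E1)))
    (A_inj : set_inj M A)
    (f : E1) (Mf : M f) (F : E2) (F_def : F = A f) :
  (forall (d : nat -> measure_display) (X : forall m, measurableType (d m))
      (mu : forall m, probability (X m) R)
      (FS : forall m, X m -> E2) (AS : forall m, X m -> {linear E1 -> E2})
      (gamma : nat -> R),
    (forall m, (0 < m)%N -> forall S, bounded_operator (AS m S)) ->
    (forall m, (0 < m)%N -> 0 < gamma m) ->
    forall m, (0 < m)%N -> forall S : X m,
      exists! fS : E1,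
        minimizer M (regularized_risk (gamma m) (FS m S) (AS m S)) fS)
  /\
  (forall eps C1 C2 : R, 0 < eps -> 0 < C1 -> 0 <= C2 ->
    (C1 + C2 * `|f|) ^+ 2 < eps ->
    exists gamma0 : R, 0 < gamma0 /\
      forall (d : nat -> measure_display) (X : forall m, measurableType (d m))
        (mu : forall m, probability (X m) R)
        (FS : forall m, X m -> E2) (AS : forall m, X m -> {linear E1 -> E2})
        (gamma : nat -> R),
      (forall m, (0 < m)%N -> forall S, bounded_operator (AS m S)) ->
      (forall m, (0 < m)%N -> 0 < gamma m) ->
      forall fS : forall m, X m -> E1,
      (forall m, (0 < m)%N -> forall S : X m,
        minimizer M (regularized_risk (gamma m) (FS m S) (AS m S)) (fS m S)) ->
      forall m, (0 < m)%N -> gamma m <= gamma0 ->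
        ((mu m)^*%mu [set S : X m | (eps < `|fS m S - f| ^+ 2)%R] <=
         (mu m)^*%mu [set S : X m | (C1 * Num.sqrt (gamma m) < `|FS m S - F|)%R]
         + (mu m)^*%mu
             [set S : X m |
               (C2 * Num.sqrt (gamma m) < opnorm (AS m S \- A))%R])%E).
Proof.
have Mmid := convex_midpoint_closed M_convex.
split.
  move=> d X mu FS AS gamma ASb gamma0 m m0 S.
  have [fS min_fS] := minimizer_regularized_risk_exists (FS m S) (gamma0 m m0)
    (ASb m m0 S) M_nonempty M_closed Mmid.
  exists fS; split=> // g.
  exact: (minimizer_regularized_risk_unique (gamma0 m m0) Mmid min_fS).
move=> eps C1 C2 eps0 C10 C20 ceps.
set c := (C1 + C2 * `|f|) ^+ 2 in ceps.
have [n nP] := near_injective_image_close A_bounded Mf M_closed Mmid A_inj ceps.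
pose r := Num.sqrt (`|f| ^+ 2 + c).
have rE : `|f| ^+ 2 + c = r ^+ 2 by rewrite sqr_sqrtr// addr_ge0 ?sqr_ge0.
pose k := r + C1 + C2 * r.
have r0 : 0 <= r by exact: sqrtr_ge0.
have k0 : 0 < k by apply: ltr_wpDr; [exact: mulr_ge0|exact: ltr_wpDl].
(* Chosen so that [gamma m <= gamma0] forces [(k * sqrt (gamma m))^2 <= n.+1^-1], the closeness of
   images required by [nP]. *)
exists (n.+1%:R^-1 / k ^+ 2); split.
  by rewrite divr_gt0 ?exprn_gt0 ?invr_gt0.
move=> d X mu FS AS gamma ASb gamma0 fS min_fS m m0 gm.
have g0 := gamma0 _ m0.
(* Subadditivity and monotonicity of the outer measure leave a pointwise inclusion, with no
   measurability involved. *)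
apply: le_trans (outer_measureU2 _ _ _); apply: le_outer_measure => S /= far.
have [GF|GF] := ltP (C1 * Num.sqrt (gamma m)) `|FS m S - F|; first by left.
right; rewrite /= ltNge; apply/negP => BA; move: GF; rewrite F_def => GF.
have [hr hA] := regularized_risk_minimizer_bounds A_bounded Mf (ASb m m0 S) g0
  (ltW C10) C20 r0 rE GF BA (min_fS m m0 S).
move: far; rewrite ltNge => /negP; apply; apply: nP.
- by case: (min_fS m m0 S).
- by rewrite rE ler_sqr ?nnegrE.
- apply: (@le_trans _ _ ((k * Num.sqrt (gamma m)) ^+ 2)).
    by rewrite ler_sqr ?nnegrE// mulr_ge0 ?sqrtr_ge0// ltW.
  by rewrite exprMn sqr_sqrtr ?(ltW g0)// mulrC -ler_pdivlMr ?exprn_gt0.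
Qed.
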